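(* Consider the (symmetric) linear system $$\begin{pmatrix}a_{00}&c^\top\\ c&A\end{pmatrix}\begin{pmatrix}\epsilon\\ y\end{pmatrix}=\begin{pmatrix}\delta\\ b-c\end{pmatrix},$$ with unknowns $\epsilon\in\mathbb{R}$ and $y\in\mathbb{R}^L$, where $A=(A_{ij})\in\mathbb{R}^{L\times L}$ and $b=(b_i),c=(c_i)\in\mathbb{R}^L$ are given by $$A_{ij}:=a(\xi_j,\xi_i),\qquad b_i:=b(\xi_i),\qquad c_i:=a(\widetilde u_{\mathbb{W}},\xi_i),\qquad i,j=1,\dots,L,$$ and $$\delta:=b(u^{\mathrm{loc}}_{\mathbb{W}})-\|u^{\mathrm{loc}}_{\mathbb{W}}\|_{\mathbb{X}}^2,\qquad a_{00}:=\|u_{\mathbb{W}}\|_{\mathbb{X}}^2-\|u^{\mathrm{loc}}_{\mathbb{W}}\|_{\mathbb{X}}^2-2\delta.$$ Then the predicted error reduction $\Delta e_{\mathbb{W},\mathbb{Y}}^2:=\|u_{\mathbb{X}}-u_{\mathbb{W}}\|_{\mathbb{X}}^2-\|u_{\mathbb{X}}-u_{\mathbb{Y}}\|_{\mathbb{X}}^2$ can be computed by $$\Delta e_{\mathbb{W},\mathbb{Y}}^2=y^\top(b-c)-\|u^{\mathrm{loc}}_{\mathbb{W}}\|_{\mathbb{X}}^2+\epsilon\,\delta.$$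
   Context: $\mathbb{X}$ is a real Hilbert space, $a:\mathbb{X}\times\mathbb{X}\to\mathbb{R}$ a bounded, symmetric, $\mathbb{X}$-elliptic bilinear form with induced norm $\|v\|_{\mathbb{X}}:=a(v,v)^{1/2}$, and $b:\mathbb{X}\to\mathbb{R}$ a bounded linear form (the same letter $b$ also denotes the vector with entries $b(\xi_i)$). $u_{\mathbb{X}}\in\mathbb{X}$ is the solution of $a(u_{\mathbb{X}},v)=b(v)$ for all $v\in\mathbb{X}$. $\mathbb{W}\subseteq\mathbb{X}$ is a finite-dimensional subspace with basis $\phi_1,\dots,\phi_N$, and $u_{\mathbb{W}}\in\mathbb{W}$ solves $a(u_{\mathbb{W}},w)=b(w)$ for all $w\in\mathbb{W}$. For an index set $\mathcal{I}^{\mathrm{loc}}\subset\{1,\dots,N\}$ let $\mathbb{W}^{\mathrm{loc}}:=\operatorname{span}\{\phi_i:i\in\mathcal{I}^{\mathrm{loc}}\}$ and $\Pi^{\mathrm{loc}}:\mathbb{W}\to\mathbb{W}^{\mathrm{loc}}$, $\sum_{i=1}^Nv_i\phi_i\mapsto\sum_{i\in\mathcal{I}^{\mathrm{loc}}}v_i\phi_i$. Put $u^{\mathrm{loc}}_{\mathbb{W}}:=\Pi^{\mathrm{loc}}u_{\mathbb{W}}$ and $\widetilde u_{\mathbb{W}}:=u_{\mathbb{W}}-u^{\mathrm{loc}}_{\mathbb{W}}$. $\xi_1,\dots,\xi_L\in\mathbb{X}$ are linearly independent elements such that $\mathbb{Y}:=\operatorname{span}\{\widetilde u_{\mathbb{W}},\xi_1,\dots,\xi_L\}$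 has dimension $L+1$. $u_{\mathbb{Y}}\in\mathbb{Y}$ solves $a(u_{\mathbb{Y}},v)=b(v)$ for all $v\in\mathbb{Y}$. *)

(* Defs.v *)
From HB Require Import structures.
From mathcomp Require Import all_boot all_order all_algebra.
From mathcomp Require Import all_classical all_reals all_analysis.
Import Order.TTheory GRing.Theory Num.Theory.
Import numFieldNormedType.Exports.

Set Implicit Arguments.
Unset Strict Implicit.
Unset Printing Implicit Defensive.

Local Open Scope classical_set_scope.
Local Open Scope ring_scope.

Section LinearAlgebra.
Context {R : realType} {X : lmodType R}.

Definition lincomb n (e : 'I_n -> X) (c : 'rV[R]_n) : X :=
  \sum_i c 0 i *: e i.

Definition lin_indep n (e : 'I_n -> X) : Prop :=
  forall c : 'rV[R]_n, lincomb e c = 0 -> c = 0.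

Definition lin_span n (e : 'I_n -> X) : set X :=
  [set v | exists c, v = lincomb e c].

Definition lin_basis n (e : 'I_n -> X) (V : set X) : Prop :=
  lin_indep e /\ V = lin_span e.

Definition has_dim (V : set X) (n : nat) : Prop :=
  exists e : 'I_n -> X, lin_basis e V.

(* The family (v, e_1, ..., e_n). *)
Definition fam_cons n (v : X) (e : 'I_n -> X) (i : 'I_(1 + n)%N) : X :=
  match fintype.split i with inl _ => v | inr j => e j end.

(* Coordinates of v in a basis e; the value 0 outside the span is junk. *)
Definition coords n (e : 'I_n -> X) (v : X) : 'rV[R]_n :=
  xget 0 [set c | v = lincomb e c].

Definition proj_loc n (e : 'I_n -> X) (I : {set 'I_n}) (v : X) : X :=
  \sum_(i in I) coords e v 0 i *: e i.

Lemma lincombB n (e : 'I_n -> X) (c d : 'rV[R]_n) :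
  lincomb e (c - d) = lincomb e c - lincomb e d.
Proof.
rewrite /lincomb -sumrB; apply: eq_bigr => i _.
by rewrite !mxE scalerBl.
Qed.

Lemma coordsE n (e : 'I_n -> X) (c : 'rV[R]_n) :
  lin_indep e -> coords e (lincomb e c) = c.
Proof.
move=> he; rewrite /coords; apply: xget_unique => //= d hd.
by apply/eqP; rewrite -subr_eq0; apply/eqP/he; rewrite lincombB -hd subrr.
Qed.

Lemma proj_locE n (e : 'I_n -> X) (I : {set 'I_n}) (c : 'rV[R]_n) :
  lin_indep e -> proj_loc e I (lincomb e c) = \sum_(i in I) c 0 i *: e i.
Proof. by move=> he; rewrite /proj_loc coordsE. Qed.

(* Solution of the variational problem for the form a and right-hand side b,
   posed on the subspace V. *)
Definition var_solution (a : X -> X -> R) (b : X -> R) (V : set X) (u : X) :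
  Prop := V u /\ forall v, V v -> a u v = b v.

Definition energy_norm (a : X -> X -> R) (v : X) : R := Num.sqrt (a v v).

End LinearAlgebra.

Section HilbertSpace.
Context {R : realType} {X : completeNormedModType R}.

(* X is a Hilbert space: it is complete for the norm induced by ip. *)
Definition hilbert_inner_product (ip : {dot X for idfun}) : Prop :=
  forall x : X, `|x| = Num.sqrt (ip x x).

Definition bounded_form2 (a : X -> X -> R) : Prop :=
  exists C : R, forall u v : X, `|a u v| <= C * `|u| * `|v|.

Definition elliptic (a : X -> X -> R) : Prop :=
  exists2 alpha : R, 0 < alpha & forall v : X, alpha * `|v| ^+ 2 <= a v v.

Definition bounded_form1 (b : X -> R) : Prop :=
  exists C : R, forall v : X, `|b v| <= C * `|v|.

End HilbertSpace.

(* Main.v *)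
Require Import Defs.
From HB Require Import structures.
From mathcomp Require Import all_boot all_order all_algebra.
From mathcomp Require Import all_classical all_reals all_analysis.
From mathcomp Require Import ring.
Import Order.TTheory GRing.Theory Num.Theory.
Import numFieldNormedType.Exports.
Local Open Scope classical_set_scope.
Local Open Scope ring_scope.

(** The matrix of the system is the Gram matrix, for [a], of the family
    [ut, xi_1, ..., xi_L], and its right-hand side is the residual of [ut]
    tested against that family.  For [a00] and [delta] this is hidden by their
    definitions, which avoid testing with [ut] directly; it comes out because
    [uloc] lies in [W], so that [a uW uloc = b uloc] and therefore
    [delta = a ut uloc = b ut - a ut ut] and [a00 = a ut ut].

    Consequently [(eps, y)] solves the system if and only if
    [ut + (eps *: ut + sum_i y_i *: xi_i)] is the Galerkin solution on [Y]
    ([gram_systemP], [var_solution_spanP]).  That solution is [uY] by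
    ellipticity ([var_solution_span_uniq]), and its coordinates are unique
    because [L + 1] vectors spanning a space of dimension [L + 1] are
    independent ([spanning_family_free]): the system has exactly one solution.

    By Galerkin orthogonality the squared error of a Galerkin solution [u] is
    [b uX - b u] ([galerkin_error]), so the predicted error reduction is
    [b uY - b uW].  Expanding [uY] and [uW] over [ut], the [xi_i] and [uloc],
    and eliminating [a ut (sum_i y_i *: xi_i)] with the first row of the system,
    gives the formula. *)

(** * Coordinates and independence *)

Lemma lincombD {R : realType} {X : lmodType R} n (e : 'I_n -> X)
  (c d : 'rV[R]_n) : lincomb e (c + d) = lincomb e c + lincomb e d.
Proof.
by rewrite /lincomb -big_split; apply: eq_bigr => i _; rewrite mxE scalerDl.
Qed.

Lemma lincomb_delta {R : realType} {X : lmodType R} n (e : 'I_n -> X)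
  (i : 'I_n) : lincomb e (delta_mx 0 i) = e i.
Proof.
rewrite /lincomb (bigD1 i) //= big1 => [|j ji]; rewrite mxE eqxx /=.
  by rewrite eqxx scale1r addr0.
by rewrite (negPf ji) scale0r.
Qed.

Lemma lincomb_mulmx {R : realType} {X : lmodType R} {n m} {e : 'I_n -> X}
  {f : 'I_m -> X} {M : 'M[R]_(m, n)} (c : 'rV[R]_m) :
  (forall i, f i = lincomb e (row i M)) ->
  lincomb f c = lincomb e (c *m M).
Proof.
move=> fE; rewrite /lincomb.
under eq_bigr do rewrite fE scaler_sumr.
rewrite exchange_big; apply: eq_bigr => j _ /=.
by rewrite mxE scaler_suml; apply: eq_bigr => i _; rewrite mxE scalerA.
Qed.

Lemma lin_span_coef {R : realType} {X : lmodType R} {n m} (e : 'I_n -> X)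
  (f : 'I_m -> X) :
  (forall i, lin_span e (f i)) ->
  exists M : 'M[R]_(m, n), forall i, f i = lincomb e (row i M).
Proof.
move=> /choice[g gE]; exists (\matrix_(i < m) g i) => i.
by rewrite rowK gE.
Qed.

(** If [e] is a basis of the span, write [e] through [f] with a matrix [M] and
    [f] through [e] with [P].  Independence of [e] gives [M *m P = 1], hence
    [P *m M = 1] since both are square, so [P] has no left kernel. *)
Lemma spanning_family_free {R : realType} {X : lmodType R} {n}
  {f : 'I_n -> X} : has_dim (lin_span f) n -> lin_indep f.
Proof.
move=> [e [e_free spanE]].
have [i|M eM] := lin_span_coef f e.
  by rewrite spanE; exists (delta_mx 0 i); rewrite lincomb_delta.
have [i|P fP] := lin_span_coef e f.
  by rewrite -spanE; exists (delta_mx 0 i); rewrite lincomb_delta.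
have MP1 : M *m P = 1%:M.
  apply/row_matrixP => i; apply/eqP; rewrite -subr_eq0; apply/eqP/e_free.
  rewrite lincombB row_mul -(lincomb_mulmx _ fP) -eM.
  by rewrite row1 lincomb_delta subrr.
move=> c; rewrite (lincomb_mulmx _ fP) => /e_free cP0.
by rewrite -[c]mulmx1 -(mulmx1C MP1) mulmxA cP0 mul0mx.
Qed.

Lemma lincomb_fam_cons {R : realType} {X : lmodType R} n (v : X)
  (e : 'I_n -> X) (s : R) (c : 'rV[R]_n) :
  lincomb (fam_cons v e) (row_mx s%:M c) = s *: v + lincomb e c.
Proof.
rewrite /lincomb big_split_ord big_ord1 /fam_cons; congr (_ *: _ + _).
- by rewrite row_mxEl mxE eqxx.
- by case: splitP => [//|k /= /eqP]; rewrite ltn_eqF.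
apply: eq_bigr => i _; rewrite row_mxEr; congr (_ *: _).
case: splitP => [[[]] //|k /= /eqP].
by rewrite eqn_add2l => /eqP/val_inj ->.
Qed.

Lemma lincomb_fam_cons_head {R : realType} {X : lmodType R} n (v : X)
  (e : 'I_n -> X) : lincomb (fam_cons v e) (row_mx (1 : R)%:M 0) = v.
Proof.
rewrite lincomb_fam_cons scale1r /lincomb big1 ?addr0 // => i _.
by rewrite mxE scale0r.
Qed.

(** * Galerkin solutions on a span *)

Lemma linear_lincomb {R : realType} {X : lmodType R} {n} (e : 'I_n -> X)
  (f : {scalar X}) (c : 'rV[R]_n) : f (lincomb e c) = \sum_i c 0 i * f (e i).
Proof. by rewrite linear_sum; apply: eq_bigr => i _; rewrite linearZ. Qed.

Lemma symmetric_formC {R : realType} {X : lmodType R} (a : {symmetric X})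
  (u v : X) : a u v = a v u.
Proof. by rewrite hermC mul1r. Qed.

(** A bordered Gram system says, row by row, what the form takes on each
    generator when tested with the combination whose coordinates are the
    unknowns. *)
Lemma gram_systemP {R : realType} {X : lmodType R} (a : {symmetric X}) n
  (v0 : X) (e : 'I_n -> X) (d s : R) (r y : 'cV[R]_n) :
  block_mx ((a v0 v0)%:M : 'M[R]_1) (\col_i a v0 (e i))^T (\col_i a v0 (e i))
    (\matrix_(i, j) a (e j) (e i)) *m col_mx (s%:M : 'M[R]_1) y
    = col_mx (d%:M : 'M[R]_1) r <->
  let v := lincomb (fam_cons v0 e) (row_mx s%:M y^T) in
  a v v0 = d /\ forall i, a v (e i) = r i 0.
Proof.
rewrite /= lincomb_fam_cons mul_block_col.
have vE w : a (s *: v0 + lincomb e y^T) w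
    = s * a v0 w + \sum_i y i 0 * a (e i) w.
  rewrite linearDl linearZl_LR /=; congr (_ + _).
  rewrite symmetric_formC linear_lincomb; apply: eq_bigr => i _.
  by rewrite mxE symmetric_formC.
split.
- move=> /eq_col_mx[/matrixP E1 /matrixP E2]; split.
    move: (E1 0 0); rewrite !mxE vE !big_ord1 !mxE /= !mulr1n => <-.
    rewrite mulrC; congr (_ + _).
    by apply: eq_bigr => i _; rewrite !mxE symmetric_formC mulrC.
  move=> i; rewrite -E2 !mxE vE !big_ord1 !mxE /= ?mulr1n mulrC; congr (_ + _).
  by apply: eq_bigr => j _; rewrite !mxE mulrC.
- case=> E1 E2; congr col_mx; apply/matrixP => i j; rewrite !ord1.
    rewrite !mxE -E1 vE !big_ord1 !mxE /= ?mulr1n mulrC; congr (_ + _).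
    by apply: eq_bigr => k _; rewrite !mxE symmetric_formC mulrC.
  rewrite -E2 !mxE vE !big_ord1 !mxE /= ?mulr1n mulrC; congr (_ + _).
  by apply: eq_bigr => k _; rewrite !mxE mulrC.
Qed.

(** The variational problem on a span need only be tested on the generators.
    The solution is written as [v0] plus a correction [v], which moves the
    residual of [v0] to the right-hand side. *)
Lemma var_solution_spanP {R : realType} {X : lmodType R} (a : {symmetric X})
  (b : {scalar X}) n (v0 : X) (e : 'I_n -> X) (c : 'rV[R]_(1 + n)) :
  let v := lincomb (fam_cons v0 e) c in
  var_solution a b (lin_span (fam_cons v0 e)) (v0 + v) <->
  a v v0 = b v0 - a v0 v0 /\ forall i, a v (e i) = b (e i) - a v0 (e i).
Proof.
move=> v.
have span_head : lin_span (fam_cons v0 e) v0.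
  by exists (row_mx 1%:M 0); rewrite lincomb_fam_cons_head.
have span_tail i : lin_span (fam_cons v0 e) (e i).
  exists (row_mx 0%:M (delta_mx 0 i)).
  by rewrite lincomb_fam_cons scale0r add0r lincomb_delta.
split=> [sol|[E1 E2]].
  split=> [|i].
    by rewrite -(proj2 sol _ span_head) linearDl addrAC subrr add0r.
  by rewrite -(proj2 sol _ (span_tail i)) linearDl addrAC subrr add0r.
split.
  have [d dE] := span_head.
  by exists (d + c); rewrite lincombD -dE.
move=> _ [d ->]; rewrite !linear_lincomb; apply: eq_bigr => i _.
rewrite /fam_cons /=; case: (fintype.split i) => [_|j]; rewrite linearDl /= ?E1 ?E2.
all: by rewrite [_ + (_ - _)]addrC subrK.
Qed.

(** * Ellipticity and the energy error *)

Lemma elliptic_ge0 {R : realType} {X : completeNormedModType R}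
  (a : X -> X -> R) : elliptic a -> forall v, 0 <= a v v.
Proof.
move=> [alpha alpha0 ell] v; apply: le_trans (ell v).
by rewrite mulr_ge0 ?exprn_ge0 // ltW.
Qed.

Lemma elliptic_eq0 {R : realType} {X : completeNormedModType R}
  {a : X -> X -> R} : elliptic a -> forall v, a v v = 0 -> v = 0.
Proof.
move=> [alpha alpha0 ell] v av0; move: (ell v); rewrite av0 pmulr_rle0 //.
by rewrite exprn_even_le0 //= normr_eq0 => /eqP.
Qed.

Lemma energy_norm_sqr {R : realType} {X : completeNormedModType R}
  (a : X -> X -> R) : elliptic a -> forall v, energy_norm a v ^+ 2 = a v v.
Proof. by move=> /elliptic_ge0 ge0 v; rewrite sqr_sqrtr. Qed.

Lemma var_solution_span_uniq {R : realType} {X : completeNormedModType R}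
  (a : {symmetric X}) (b : {scalar X}) n (e : 'I_n -> X) (u v : X) :
  elliptic a -> var_solution a b (lin_span e) u ->
  var_solution a b (lin_span e) v -> u = v.
Proof.
move=> ell [[c uE] solu] [[d vE] solv].
have span_diff : lin_span e (u - v) by exists (c - d); rewrite lincombB -uE -vE.
apply/eqP; rewrite -subr_eq0; apply/eqP/(elliptic_eq0 ell).
by rewrite linearBl /= solu // solv // subrr.
Qed.

(** [a u u = b u = a uX u] since [u] may be tested with itself in both
    problems, so the expanded square collapses to [a uX uX - a u u]. *)
Lemma galerkin_error {R : realType} {X : completeNormedModType R}
  {a : {symmetric X}} {b : {scalar X}} {V : set X} {uX u : X} :
  elliptic a -> var_solution a b [set: X] uX -> var_solution a b V u ->
  energy_norm a (uX - u) ^+ 2 = b uX - b u.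
Proof.
move=> ell [_ solX] [Vu solV]; rewrite energy_norm_sqr //.
rewrite linearBl /= solX // linearBr /= (symmetric_formC a u uX) solX // solV //.
by rewrite linearB /= subrr subr0.
Qed.

(** * The predicted error reduction *)

Theorem theorem16 (R : realType) (X : completeNormedModType R)
  (ip : {dot X for idfun}) (hX : hilbert_inner_product ip)
  (a : {symmetric X}) (ha_bdd : bounded_form2 a) (ha_ell : elliptic a)
  (b : {scalar X}) (hb : bounded_form1 b)
  (uX : X) (huX : var_solution a b [set: X] uX)
  (N : nat) (phi : 'I_N -> X) (W : set X) (hW : lin_basis phi W)
  (uW : X) (huW : var_solution a b W uW)
  (Iloc : {set 'I_N})
  (uloc : X) (huloc : uloc = proj_loc phi Iloc uW)
  (ut : X) (hut : ut = uW - uloc)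
  (L : nat) (xi : 'I_L -> X) (hxi : lin_indep xi)
  (Y : set X) (hY : Y = lin_span (fam_cons ut xi))
  (hdimY : has_dim Y L.+1)
  (uY : X) (huY : var_solution a b Y uY) :
  let A : 'M[R]_L := \matrix_(i, j) a (xi j) (xi i) in
  let bvec : 'cV[R]_L := \col_i b (xi i) in
  let c : 'cV[R]_L := \col_i a ut (xi i) in
  let delta : R := b uloc - energy_norm a uloc ^+ 2 in
  let a00 : R :=
    energy_norm a uW ^+ 2 - energy_norm a uloc ^+ 2 - 2 * delta in
  let linear_system (eps : R) (y : 'cV[R]_L) : Prop :=
    block_mx (a00%:M : 'M[R]_1) c^T c A *m col_mx (eps%:M : 'M[R]_1) y
    = col_mx (delta%:M : 'M[R]_1) (bvec - c) in
  (exists! s : R * 'cV[R]_L, linear_system s.1 s.2) /\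
  forall (eps : R) (y : 'cV[R]_L), linear_system eps y ->
    energy_norm a (uX - uW) ^+ 2 - energy_norm a (uX - uY) ^+ 2
    = (y^T *m (bvec - c)) 0 0 - energy_norm a uloc ^+ 2 + eps * delta.
Proof.
move=> A bvec c delta a00 linear_system.
have [WuW solW] := huW.
have Wloc : W uloc.
  case: hW => _ ->; exists (\row_i if i \in Iloc then coords phi uW 0 i else 0).
  rewrite huloc /proj_loc /lincomb big_mkcond; apply: eq_bigr => i _ /=.
  by rewrite mxE; case: ifP; rewrite ?scale0r.
have uWE : uW = ut + uloc by rewrite hut subrK.
have auWloc := solW _ Wloc; have auWW := solW _ WuW.
have deltaE : delta = a ut uloc.
  by rewrite /delta energy_norm_sqr // hut linearBl /= auWloc.
have a00E : a00 = a ut ut.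
  rewrite /a00 !energy_norm_sqr // deltaE uWE linearDl /= !linearDr /=.
  rewrite (symmetric_formC a uloc ut); ring.
(* Both terms of ut = uW - uloc lie in W, so ut is an admissible test vector. *)
have butE : b ut = a uW ut by rewrite hut linearB linearBr /= auWW auWloc.
have delta_ut : delta = b ut - a ut ut.
  rewrite butE uWE linearDl /= deltaE symmetric_formC; ring.
have systemP eps y : linear_system eps y <->
    var_solution a b Y (ut + lincomb (fam_cons ut xi) (row_mx eps%:M y^T)).
  rewrite /linear_system a00E gram_systemP hY var_solution_spanP -delta_ut.
  by split=> -[E1 E2]; split=> // i; rewrite E2 !mxE.
have free : lin_indep (fam_cons ut xi).
  by apply: spanning_family_free; rewrite -hY.
have uY_uniq u : var_solution a b Y u -> u = uY.
  by move: huY; rewrite hY => solY sol; apply: var_solution_span_uniq sol solY.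
split.
  have [d dE] : exists d, uY = ut + lincomb (fam_cons ut xi) d.
    have [] := huY; rewrite hY => -[d ->] _.
    exists (d - row_mx 1%:M 0).
    by rewrite lincombB lincomb_fam_cons_head addrC subrK.
  exists (lsubmx d 0 0, (rsubmx d)^T); split=> /=.
    by apply/systemP; rewrite trmxK -mx11_scalar hsubmxK -dE.
  move=> [eps y] /= /systemP/uY_uniq; rewrite dE => /addrI /eqP.
  rewrite -subr_eq0 -lincombB => /eqP/free/eqP; rewrite subr_eq0 => /eqP <-.
  by rewrite row_mxKl row_mxKr trmxK mxE.
move=> eps y sys.
have /systemP/uY_uniq uYE := sys.
rewrite (galerkin_error ha_ell huX huW).
rewrite (galerkin_error ha_ell huX huY).
(* The first row of the system, a v ut = delta with v = eps *: ut + y . xi. *)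
move: sys; rewrite /linear_system a00E => /gram_systemP[row0 _].
rewrite lincomb_fam_cons in row0 uYE.
have ylin (f : {scalar X}) : (y^T *m \col_i f (xi i)) 0 0 = f (lincomb xi y^T).
  by rewrite linear_lincomb mxE; apply: eq_bigr => i _; rewrite !mxE.
have -> : (y^T *m (bvec - c)) 0 0 = b (lincomb xi y^T) - a ut (lincomb xi y^T).
  by rewrite mulmxBr mxE [in X in _ + X]mxE !ylin.
move: row0; rewrite linearDl linearZl_LR /= (symmetric_formC a (lincomb _ _) ut).
rewrite -uYE uWE !(linearD b) linearZ /= => row0.
have norm_loc : energy_norm a uloc ^+ 2 = b uloc - delta by rewrite /delta; ring.
rewrite norm_loc; move: row0 delta_ut; clearbody delta => row0 delta_ut.
have -> : b ut = delta + a ut ut by rewrite delta_ut; ring.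
have -> : a ut (lincomb xi y^T) = delta - eps * a ut ut by rewrite -row0; ring.
ring.
Qed.
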